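(* Let $G$ be a graph with maximum degree $\Delta = 3$. If $\mathrm{mad}(G) < \frac{36}{13}$, then $\chi_i(G) \leq 5$.
   Context: All graphs are finite and simple. For a graph $G$, $\mathrm{mad}(G)$ denotes the maximum average degree of $G$, i.e. the maximum of $2|E(H)|/|V(H)|$ over all nonempty subgraphs $H$ of $G$. An injective coloring of $G$ is an assignment of colors to the vertices of $G$ such that any two vertices having a common neighbor receive distinct colors. The injective chromatic number $\chi_i(G)$ is the minimum number of colors in an injective coloring of $G$. *)

(* Defs.v *)
From mathcomp Require Import all_boot all_order all_algebra.

Set Implicit Arguments.
Unset Strict Implicit.
Unset Printing Implicit Defensive.

Import Order.TTheory GRing.Theory Num.Theory.

Record sgraph := SGraph {
  vertex :> finType;
  adj : rel vertex;
  adj_sym : symmetric adj;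
  adj_irrefl : irreflexive adj }.

Definition degree (G : sgraph) (x : G) : nat := #|[set y | adj x y]|.

Definition max_degree (G : sgraph) : nat := \max_(x : G) degree x.

Definition edges (G : sgraph) : {set {set G}} :=
  [set e | [exists x : G, exists y : G, adj x y && (e == [set x; y])]].

(* The pair (W, F) is the subgraph with vertex set W and edge set F. *)
Definition is_subgraph (G : sgraph) (H : {set G} * {set {set G}}) : bool :=
  (H.2 \subset edges G) && [forall e in H.2, e \subset H.1].

(* The default value 0 is harmless since all average degrees are
   nonnegative; it is the value of [mad] only for edgeless graphs. *)
Definition mad (G : sgraph) : rat :=
  (\big[Num.max/0]_(H : {set G} * {set {set G}}
                     | is_subgraph H && (H.1 != set0))
     (2 * #|H.2|%:R / #|H.1|%:R))%R.

Definition injective_coloring (G : sgraph) (C : eqType) (f : G -> C) : bool :=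
  [forall u, forall v,
     (u != v) && [exists w, adj u w && adj v w] ==> (f u != f v)].

Definition injectively_colorable (G : sgraph) (k : nat) : bool :=
  [exists f : {ffun G -> 'I_k}, injective_coloring f].

Lemma injectively_colorable_card (G : sgraph) : injectively_colorable G #|G|.
Proof.
apply/existsP; exists [ffun x => enum_rank x].
apply/forallP=> u; apply/forallP=> v; apply/implyP=> /andP[uv _].
by rewrite !ffunE (inj_eq enum_rank_inj).
Qed.

Definition injective_chromatic_number (G : sgraph) : nat :=
  ex_minn (ex_intro (fun k => injectively_colorable G k) #|G|
                    (injectively_colorable_card G)).

(* Main.v *)
(** Take a counterexample with fewest edges.  Deleting the edges inside a set
    of vertices and recolouring that set greedily shows that it has no vertex
    of degree 1, no two adjacent 2-vertices, no 3-vertex with two 2-neighbours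
    and no two adjacent 3-vertices that both have a 2-neighbour.  Let A, B, C
    be the sets of 2-vertices, of 3-vertices with a 2-neighbour, and of the
    other 3-vertices.  Counting the A-B and B-C edges gives 2|A| <= |B| and
    2|B| <= 3|C|, whence the average degree is at least 36/13. *)
Require Import Defs.
From mathcomp Require Import all_boot all_order all_algebra.
From mathcomp Require Import zify.

Set Implicit Arguments.
Unset Strict Implicit.
Unset Printing Implicit Defensive.

Import Order.TTheory GRing.Theory Num.Theory.

(** * Partial injective colorings and their greedy extension *)

Section Relations.

Variable T : finType.
Implicit Types (e : rel T) (A W X Y : {set T}) (s : seq T).

Definition nbrs e (x : T) : {set T} := [set y | e x y].

(** The coloring counts only on [A], but the common neighbor [w] may lie outside [A], so that
    constraints through uncolored vertices are kept. *)
Definition injective_on e A k (f : T -> 'I_k) : Prop :=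
  forall u v w, u \in A -> v \in A -> u != v -> e u w -> e v w -> f u != f v.

Definition colorable e k : Prop := exists f : T -> 'I_k, injective_on e setT f.

(** The colors forbidden at [x] are those of the vertices of [A] reached from [x] in two steps; the
    sum bounds their number, grouped by middle vertex [w]. *)
Lemma injective_on_extend e A k (f : T -> 'I_k) x :
    symmetric e -> injective_on e A f ->
    \sum_(w in nbrs e x) #|nbrs e w :&: A| < k ->
  exists g : T -> 'I_k, injective_on e (x |: A) g.
Proof.
move=> symE fP ltk; pose F := \bigcup_(w in nbrs e x) (nbrs e w :&: A).
have /existsP[c cP]: [exists c, c \notin f @: F].
  rewrite -negb_forall; apply/negP => /forallP fF.
  have : #|'I_k| <= #|F|.
    apply: leq_trans (leq_imset_card f F).
    by apply/subset_leq_card/subsetP => c _; apply: fF.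
  have FE : #|F| <= \sum_(w in nbrs e x) #|nbrs e w :&: A|.
    rewrite /F; elim/big_rec2: _ => [|w n B _ IH]; first by rewrite cards0.
    by apply: leq_trans (leq_card_setU _ _) _; rewrite leq_add2l.
  by rewrite card_ord => /leq_trans/(_ FE); rewrite leqNgt ltk.
have cF u w : u \in A -> e u w -> e x w -> c != f u.
  move=> uA uw xw; apply: contraNneq cP => ->; apply: imset_f.
  by apply/bigcupP; exists w; rewrite !inE // symE uw.
exists (fun y => if y == x then c else f y) => u v w.
rewrite !inE; case: (eqVneq u x) => [->|ux]; case: (eqVneq v x) => [->|vx] //=.
- by move=> _ vA _ xw vw; apply: cF vA vw xw.
- by move=> uA _ _ uw xw; rewrite eq_sym; apply: cF uA uw xw.
- exact: fP.
Qed.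

(** The list gives the coloring order, head first. When [x] is treated, the colored vertices are
    those outside the whole remaining list, [x] included. *)
Fixpoint greedy e k s : bool :=
  if s is x :: s' then
    (\sum_(w in nbrs e x) #|nbrs e w :&: ~: [set z in s]| < k) && greedy e k s'
  else true.

Lemma greedy_colorable e k s (f : T -> 'I_k) :
    symmetric e -> greedy e k s -> injective_on e (~: [set z in s]) f ->
  colorable e k.
Proof.
move=> symE; elim: s f => [|x s IHs] f /=.
  by move=> _ fP; exists f => u v w _ _; apply: fP; rewrite !inE.
case/andP=> ltk gr fP; have [g gP] := injective_on_extend symE fP ltk.
apply: (IHs g) => // u v w; rewrite !inE => us vs; apply: gP; rewrite !inE.
- by rewrite (negbTE us) orbF; case: eqP.
- by rewrite (negbTE vs) orbF; case: eqP.
Qed.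

(** * Double counting and the density condition *)

Lemma exchange_nbrs e X Y : symmetric e ->
  \sum_(x in X) #|nbrs e x :&: Y| = \sum_(y in Y) #|nbrs e y :&: X|.
Proof.
move=> symE.
have E Z x : #|nbrs e x :&: Z| = \sum_(y in Z) e x y.
  rewrite -sum1_card big_mkcond [RHS]big_mkcond /=; apply: eq_bigr => y _.
  by rewrite !inE; case: (e x y); case: (y \in Z).
under eq_bigr do rewrite E; rewrite exchange_big /=.
apply: eq_bigr => y _; rewrite E; apply: eq_bigr => x _.
by rewrite symE.
Qed.

(** The inner sum is twice the number of edges induced by [W]: this is average degree below 36/13
    for every induced subgraph, with denominators cleared. *)
Definition sparse e : Prop := forall W, W != set0 ->
  13 * (\sum_(x in W) #|nbrs e x :&: W|) < 36 * #|W|.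

Lemma sparse_sub e e' : subrel e' e -> sparse e -> sparse e'.
Proof.
move=> sub spE W /spE; apply: leq_ltn_trans; rewrite leq_mul2l /=.
apply: leq_sum => x _; apply/subset_leq_card/setSI/subsetP => y.
by rewrite !inE; apply: sub.
Qed.

(** * Reducible configurations of a minimal counterexample *)

Section MinimalCounterexample.

Variable e : rel T.
Hypothesis symE : symmetric e.
Hypothesis deg3 : forall x, #|nbrs e x| <= 3.
Hypothesis minE : forall e', symmetric e' -> subrel e' e ->
  (exists x y, e x y && ~~ e' x y) -> colorable e' 5.
Hypothesis not_colorable : ~ colorable e 5.

(* The edges inside [s] are irrelevant for pairs of vertices outside [s]. *)
Lemma not_greedy s x y : x \in s -> y \in s -> e x y -> ~~ greedy e 5 s.
Proof.
move=> xs ys xy; apply/negP => gr; apply: not_colorable.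
pose e' u v := e u v && ~~ ((u \in s) && (v \in s)).
have symE' : symmetric e' by move=> u v; rewrite /e' symE (andbC (u \in s)).
have [||f fP] := minE symE'; first by move=> u v /andP[].
  by exists x, y; rewrite /e' xy xs ys.
apply: (greedy_colorable symE gr (f := f)) => u v w.
rewrite !inE => us vs uv uw vw.
by apply: (fP u v w); rewrite ?inE // /e' ?uw ?vw ?(negbTE us) ?(negbTE vs).
Qed.

(** The uncolored vertex [x] is itself a neighbor of [w] and drops out of the count. *)
Lemma card_nbrs_out s x w d : #|nbrs e w| <= d.+1 -> x \in s -> e x w ->
  #|nbrs e w :&: ~: [set z in s]| <= d.
Proof.
move=> dw xs xw; rewrite (cardsD1 x (nbrs e w)) inE symE xw ltnS in dw.
apply: leq_trans dw; rewrite -setDE.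
apply/subset_leq_card/subsetP => z; rewrite !inE => /andP[zs ->].
by rewrite andbT; apply: contraNneq zs => ->.
Qed.

Lemma card_nbrs_out2 s x y w d : #|nbrs e w| <= d.+2 ->
    x \in s -> y \in s -> x != y -> e x w -> e y w ->
  #|nbrs e w :&: ~: [set z in s]| <= d.
Proof.
move=> dw xs ys xy xw yw.
rewrite (cardsD1 x (nbrs e w)) (cardsD1 y (_ :\ x)) in dw.
rewrite !inE eq_sym xy !(symE w) xw yw !ltnS in dw.
apply: leq_trans dw; rewrite -setDE; apply/subset_leq_card/subsetP => z.
rewrite !inE => /andP[zs ->]; rewrite andbT.
by apply/andP; split; apply: contraNneq zs => ->.
Qed.

Lemma card_nbrs_out_le2 s x w : x \in s -> e x w ->
  #|nbrs e w :&: ~: [set z in s]| <= 2.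
Proof. exact: card_nbrs_out (deg3 w). Qed.

(** At most two middle vertices, each with at most two colored neighbors, forbid at most 4
    colors. *)
Lemma greedy_deg2 s x : #|nbrs e x| <= 2 -> x \in s ->
  \sum_(w in nbrs e x) #|nbrs e w :&: ~: [set z in s]| < 5.
Proof.
move=> dx xs; apply: (@leq_ltn_trans (\sum_(w in nbrs e x) 2)); last first.
  by rewrite sum_nat_const; lia.
by apply: leq_sum => w; rewrite inE; apply: card_nbrs_out_le2.
Qed.

(** The forbidden colors number at most 1 + 1 + 2 = 4, the 2 coming from a possible third
    neighbor. *)
Lemma greedy_two s x w1 w2 : x \in s -> e x w1 -> e x w2 -> w1 != w2 ->
    #|nbrs e w1 :&: ~: [set z in s]| <= 1 ->
    #|nbrs e w2 :&: ~: [set z in s]| <= 1 ->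
  \sum_(w in nbrs e x) #|nbrs e w :&: ~: [set z in s]| < 5.
Proof.
move=> xs xw1 xw2 w12 l1 l2.
rewrite (big_setD1 w1) ?inE //= (big_setD1 w2) ?inE ?xw2 1?eq_sym ?w12 //=.
have -> : 5 = (1 + (1 + 2)).+1 by [].
rewrite ltnS !leq_add //; set D := _ :\ _ :\ _.
apply: (@leq_trans (\sum_(w in D) 2)).
  by apply: leq_sum => w; rewrite !inE => /and3P[_ _]; apply: card_nbrs_out_le2.
rewrite sum_nat_const; have := deg3 x.
rewrite (cardsD1 w1) inE xw1 (cardsD1 w2) !inE eq_sym w12 xw2 /= -/D; lia.
Qed.

(** The forbidden colors number at most 0 + 2 + 2 = 4. *)
Lemma greedy_one s x w1 : x \in s -> e x w1 ->
    #|nbrs e w1 :&: ~: [set z in s]| = 0 ->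
  \sum_(w in nbrs e x) #|nbrs e w :&: ~: [set z in s]| < 5.
Proof.
move=> xs xw1 l1; rewrite (big_setD1 w1) ?inE //= l1 add0n; set D := _ :\ _.
apply: (@leq_ltn_trans (\sum_(w in D) 2)).
  by apply: leq_sum => w; rewrite !inE => /andP[_]; apply: card_nbrs_out_le2.
rewrite sum_nat_const; have := deg3 x.
rewrite (cardsD1 w1) inE xw1 -/D; lia.
Qed.

Lemma deg_neq1 v : #|nbrs e v| <> 1.
Proof.
move=> dv; have /card_gt0P[a] : 0 < #|nbrs e v| by rewrite dv.
rewrite inE => va; have av : e a v by rewrite symE.
(* Color [a] before [v]: the only neighbor of [v] is [a] itself, so [v] forbids nothing at [a]. *)
have := @not_greedy [:: a; v] a v; rewrite !inE !eqxx orbT => /(_ isT isT av).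
rewrite /= andbT => /negP; apply; apply/andP; split.
  apply: (greedy_one (w1 := v)) => //; first by rewrite !inE eqxx.
  apply/eqP; rewrite -leqn0.
  by apply: (@card_nbrs_out _ a); rewrite ?dv ?inE ?eqxx.
by apply: greedy_deg2; rewrite ?dv ?inE.
Qed.

Lemma deg2_other v a : #|nbrs e v| = 2 -> e v a -> exists2 b, e v b & a != b.
Proof.
move=> dv va; have : 0 < #|nbrs e v :\ a|.
  by move: dv; rewrite (cardsD1 a) inE va; lia.
by case/card_gt0P=> b; rewrite !inE eq_sym => /andP[? ?]; exists b.
Qed.

(** Color [b], the other neighbor of [v], then [a], then [v]. At [b], the middle vertex [v] forbids
    nothing, as [a] and [b] are both uncolored; [a] is covered by the hypothesis, and [v] has only
    two neighbors. *)
Lemma deg2_nongreedy v a s : #|nbrs e v| = 2 -> e v a ->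
  (forall s, a \in s ->
   \sum_(w in nbrs e a) #|nbrs e w :&: ~: [set z in s]| < 5) -> False.
Proof.
move=> dv va ga; have [b vb ab] := deg2_other dv va.
have := @not_greedy [:: b; a; v] v a.
rewrite !inE !eqxx !orbT => /(_ isT isT va); rewrite /= andbT => /negP; apply; apply/and3P; split.
- apply: (greedy_one (w1 := v)); rewrite ?inE ?eqxx // 1?symE //.
  apply/eqP; rewrite -leqn0.
  by apply: (@card_nbrs_out2 _ a b); rewrite ?dv ?inE ?eqxx ?orbT // symE.
- by apply: ga; rewrite !inE eqxx.
- by apply: greedy_deg2; rewrite ?dv ?inE.
Qed.

Lemma deg2_nonadj v a : #|nbrs e v| = 2 -> e v a -> #|nbrs e a| = 3.
Proof.
move=> dv va; have := deg3 a; rewrite leq_eqVlt => /orP[/eqP//|da].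
by case: (deg2_nongreedy nil dv va) => s sa; apply: greedy_deg2.
Qed.

(** Two distinct 2-vertices next to [a] would each forbid at most one color at [a], so [a] could be
    recolored by [greedy_two]. *)
Lemma deg2_nbr_uniq a v v' : e a v -> e a v' ->
  #|nbrs e v| = 2 -> #|nbrs e v'| = 2 -> v = v'.
Proof.
move=> av av' dv dv'; apply/eqP/negPn/negP => vv'.
have va : e v a by rewrite symE.
case: (deg2_nongreedy nil dv va) => s sa.
by apply: (greedy_two sa av av' vv'); apply: card_nbrs_out sa _;
  rewrite ?dv ?dv'.
Qed.

Lemma nonadj_deg2_nbrs a b v1 v2 :
    e a b -> #|nbrs e a| = 3 -> #|nbrs e b| = 3 ->
  e a v1 -> e b v2 -> #|nbrs e v1| = 2 -> #|nbrs e v2| = 2 -> False.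
Proof.
move=> ab da db av1 bv2 d1 d2.
have neq x y : #|nbrs e x| != #|nbrs e y| -> x != y by apply: contraNneq => ->.
have v1b : v1 != b by apply: neq; rewrite d1 db.
have v2a : v2 != a by apply: neq; rewrite d2 da.
(* At [a], the vertex [v1] sees at most one colored vertex, and so does [b], because [a] and [v2]
   are uncolored. The case of [b] is symmetric, [v1] being still uncolored; the 2-vertices come
   last. *)
have := @not_greedy [:: a; b; v1; v2] a b.
rewrite !inE !eqxx !orbT => /(_ isT isT ab)/negP; apply; rewrite /= andbT.
apply/and4P; split.
- apply: (greedy_two (w1 := v1) (w2 := b)); rewrite ?inE ?eqxx //.
    by apply: (@card_nbrs_out _ a); rewrite ?d1 ?inE ?eqxx.
  apply: (@card_nbrs_out2 _ a v2); rewrite ?db ?inE ?eqxx ?orbT //.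
    by rewrite eq_sym.
  by rewrite symE.
- have ba : e b a by rewrite symE.
  apply: (greedy_two (w1 := v2) (w2 := a)); rewrite ?inE ?eqxx //.
    by apply: (@card_nbrs_out _ b); rewrite ?d2 ?inE ?eqxx.
  apply: (@card_nbrs_out2 _ b v1); rewrite ?da ?inE ?eqxx ?orbT //.
    by rewrite eq_sym.
  by rewrite symE.
- by apply: greedy_deg2; rewrite ?d1 ?inE ?eqxx.
- by apply: greedy_deg2; rewrite ?d2 ?inE ?eqxx.
Qed.

(** * Counting edges between the three classes of vertices *)

Lemma not_sparse : ~ sparse e.
Proof.
move=> spE; pose W := [set x | 0 < #|nbrs e x|].
(* [W] omits the isolated vertices, which would lower the average degree. If it is empty there are
   no edges, and a constant coloring works. *)
have [W0|/spE] := eqVneq W set0.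
  apply: not_colorable; exists (fun=> ord0) => u v w _ _ _ uw.
  have : u \in W by rewrite inE; apply/card_gt0P; exists w; rewrite inE.
  by rewrite W0 inE.
pose A := [set x | #|nbrs e x| == 2].
pose B := [set x | (#|nbrs e x| == 3) && (nbrs e x :&: A != set0)].
pose C := [set x | (#|nbrs e x| == 3) && (nbrs e x :&: A == set0)].
have WE : W = A :|: (B :|: C).
  apply/setP => x; rewrite !inE -andb_orr orNb andbT.
  have := deg3 x; have := @deg_neq1 x; case: #|_| => [|[|[|[|]]]] //.
have AD : [disjoint A & B :|: C].
  rewrite disjoints_subset; apply/subsetP => x; rewrite !inE => /eqP->.
  by [].
have BC : [disjoint B & C].
  rewrite disjoints_subset; apply/subsetP => x; rewrite !inE.
  by case/andP=> -> ->.
have cardW : #|W| = #|A| + (#|B| + #|C|).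
  by rewrite WE !cardsU !disjoint_setI0 // !cards0 !subn0.
have sumW : \sum_(x in W) #|nbrs e x :&: W| = 2 * #|A| + 3 * (#|B| + #|C|).
  rewrite (eq_bigr (fun x => #|nbrs e x|)); last first.
    move=> x _; congr #|pred_of_set _|; apply/setIidPl/subsetP => y.
    rewrite !inE => xy; apply/card_gt0P; exists x; by rewrite inE symE.
  rewrite WE (eq_bigl _ _ (fun x => in_setU x A _)) bigU //.
  rewrite (eq_bigl _ _ (fun x => in_setU x B _)) bigU //=.
  rewrite (eq_bigr (fun=> 2)) => [|x]; last by rewrite inE => /eqP.
  rewrite [X in _ + (X + _)](eq_bigr (fun=> 3)) => [|x]; last first.
    by rewrite inE => /andP[/eqP].
  rewrite [X in _ + (_ + X)](eq_bigr (fun=> 3)) => [|x]; last first.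
    by rewrite inE => /andP[/eqP].
  by rewrite !sum_nat_const; lia.
(* Both neighbors of a vertex of [A] lie in [B], and a vertex of [B] has at most one neighbor in
   [A]. *)
have AB : 2 * #|A| <= #|B|.
  have : \sum_(x in A) #|nbrs e x :&: B| = 2 * #|A|.
    rewrite mulnC -sum_nat_const; apply: eq_bigr => x; rewrite inE => /eqP dx.
    rewrite -dx; congr #|pred_of_set _|; apply/setIidPl/subsetP => y.
    rewrite !inE => xy; rewrite (deg2_nonadj dx xy) /=.
    by apply/set0Pn; exists x; rewrite !inE symE xy dx.
  rewrite exchange_nbrs // => <-; rewrite -sum1_card; apply: leq_sum => y _.
  apply/card_le1_eqP => u v.
  rewrite !inE => /andP[yu /eqP du] /andP[yv /eqP dv].
  exact: (deg2_nbr_uniq yv yu).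
(* Apart from its single neighbor [v] in [A], a vertex of [B] has its other two neighbors in [C]; a
   vertex of [C] has only three neighbors. *)
have BC3 : 2 * #|B| <= 3 * #|C|.
  apply: (@leq_trans (\sum_(x in B) #|nbrs e x :&: C|)).
    rewrite mulnC -sum_nat_const; apply: leq_sum => x; rewrite !inE.
    case/andP=> /eqP dx /set0Pn[v]; rewrite !inE => /andP[xv /eqP dv].
    have -> : 2 = #|nbrs e x :\ v|.
      by have := cardsD1 v (nbrs e x); rewrite dx inE xv; lia.
    apply/subset_leq_card/subsetP => y; rewrite !inE => /andP[yv xy].
    rewrite xy /=; have yW : y \in W.
      by rewrite inE; apply/card_gt0P; exists x; rewrite inE symE.
    move: yW; rewrite WE !inE => /or3P[/eqP dy|/andP[/eqP dy]|//].
      by rewrite (deg2_nbr_uniq xy xv dy dv) eqxx in yv.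
    case/set0Pn=> v'; rewrite !inE => /andP[yv' /eqP dv'].
    by case: (nonadj_deg2_nbrs xy dx dy xv yv' dv dv').
  rewrite exchange_nbrs // mulnC -sum_nat_const; apply: leq_sum => x.
  rewrite inE => /andP[/eqP<- _].
  exact/subset_leq_card/subsetIl.
(* With a, b, c the sizes of the classes, 13(2a + 3b + 3c) - 36(a + b + c) = 3b + 3c - 10a, and 3b +
   3c >= 5b >= 10a. *)
rewrite cardW sumW; lia.
Qed.

End MinimalCounterexample.

End Relations.

(** * From relations back to graphs and [mad] *)

Lemma colorableP (G : sgraph) k :
  reflect (colorable (@adj G) k) (injectively_colorable G k).
Proof.
apply: (iffP existsP) => [[f /forallP fP]|[f fP]].
  exists f => u v w _ _ uv uw vw; have /forallP/(_ v) := fP u.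
  by rewrite uv /= => /implyP; apply; apply/existsP; exists w; rewrite uw.
exists (finfun f); apply/forallP => u; apply/forallP => v; apply/implyP.
by case/andP=> uv /existsP[w /andP[uw vw]]; rewrite !ffunE; apply: (fP u v w).
Qed.

Lemma sparse_colorable (T : finType) (e : rel T) :
    symmetric e -> irreflexive e -> (forall x, #|nbrs e x| <= 3) -> sparse e ->
  colorable e 5.
Proof.
have [n] := ubnP #|[set p | e p.1 p.2]|.
elim: n e => // n IHn e le_n symE irrE deg3 spE.
(* Reflection by the boolean [injectively_colorable] makes the case split on the [Prop] [colorable]
   constructive; the induction is on the number of ordered adjacent pairs. *)
have [//|ncol] := colorableP (SGraph symE irrE) 5.
case: (not_sparse symE deg3 _ ncol spE) => e' symE' sub [x [y /andP[xy nxy]]].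
apply: IHn => //.
- rewrite ltnS in le_n; apply: leq_trans le_n; apply/proper_card/properP; split.
    by apply/subsetP => p; rewrite !inE; apply: sub.
  by exists (x, y); rewrite inE.
- by move=> u; apply/negP => /sub; rewrite irrE.
- move=> u; apply: leq_trans (deg3 u); apply/subset_leq_card/subsetP => z.
  by rewrite !inE; apply: sub.
- exact: sparse_sub sub spE.
Qed.

(** Count incidences: [y] maps to the edge [[set x; y]] injectively for fixed [x], and each edge has
    at most two ends. *)
Lemma sum_nbrs_le_edges (G : sgraph) (W : {set G}) :
  \sum_(x in W) #|nbrs (@adj G) x :&: W| <=
    2 * #|[set E in edges G | E \subset W]|.
Proof.
set F := [set E in edges G | _].
apply: (@leq_trans (\sum_(x in W) \sum_(E in F) (x \in E))).
  apply: leq_sum => x xW.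
  have injp : {in nbrs (@adj G) x :&: W &, injective (fun y => [set x; y])}.
    move=> y z; rewrite !inE => /andP[xy _] _ /setP/(_ y).
    rewrite !inE eqxx orbT => /esym/orP[/eqP yx|/eqP//].
    by rewrite yx adj_irrefl in xy.
  rewrite -(card_in_imset injp) -big_mkcondr sum1_card.
  apply/subset_leq_card/subsetP => E /imsetP[y].
  rewrite !inE => /andP[xy yW] ->.
  rewrite unfold_in /= !inE eqxx andbT subUset !sub1set xW yW !andbT.
  by apply/existsP; exists x; apply/existsP; exists y; rewrite xy eqxx.
rewrite exchange_big /= mulnC -sum_nat_const; apply: leq_sum => E.
rewrite !inE => /andP[/existsP[x /existsP[y /andP[_ /eqP->]]] _].
rewrite -big_mkcondr sum1_card; apply: (@leq_trans #|[set x; y]|).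
  by apply/subset_leq_card/subsetP => z; rewrite unfold_in /= => /andP[].
by rewrite cards2; case: (_ != _).
Qed.

Lemma sparse_mad (G : sgraph) :
  (mad G < 36%:R / 13%:R :> rat)%R -> sparse (@adj G).
Proof.
(* The subgraph induced by [W] is one of the competitors in the maximum defining [mad]. *)
move=> ltmad W W0; set F := [set E in edges G | E \subset W].
have subH : is_subgraph (W, F).
  apply/andP; split; first by apply/subsetP => E; rewrite inE => /andP[].
  by apply/forallP => E; apply/implyP; rewrite inE => /andP[].
have le_mad : (2 * #|F|%:R / #|W|%:R <= mad G)%R.
  by apply: (le_bigmax_cond _ (fun H => 2 * #|H.2|%:R / #|H.1|%:R)%R
    (j := (W, F))); rewrite subH.
have := le_lt_trans le_mad ltmad.
have Wpos : (0 < #|W|%:R :> rat)%R by rewrite ltr0n card_gt0.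
rewrite ltr_pdivrMr // mulrAC ltr_pdivlMr ?ltr0n // -!natrM ltr_nat.
by have := sum_nbrs_le_edges W; rewrite -/F; lia.
Qed.

Theorem theorem2 (G : sgraph) :
  max_degree G = 3 ->
  (mad G < 36%:R / 13%:R :> rat)%R ->
  (injective_chromatic_number G <= 5)%N.
Proof.
move=> maxG ltmad; rewrite /injective_chromatic_number.
case: ex_minnP => m _; apply; apply/colorableP/sparse_colorable.
- exact: adj_sym.
- exact: adj_irrefl.
- by move=> x; rewrite -maxG; apply: (leq_bigmax x).
- exact: sparse_mad.
Qed.
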